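(* Let $\mathbb P$ be a probability measure on $\Omega_+$ under which $(\omega(x))_{x\ge0}$ is stationary and ergodic, with $\omega(0,i)=1/2$ $\mathbb P$-a.s. for all $i\ge3$, and $\mathbb P[\omega(0,1)<1,\ \omega(1,1)<1]>0$. Then $\lim_{n\to\infty}X_n/n=0$ $P_0$-a.s.
   Context: Cookie environments: $\Omega_+=([1/2,1]^{\mathbb N})^{\mathbb Z}$, $\omega(x)=(\omega(x,i))_{i\ge1}$. $P_{x,\omega}$ is the law of the nearest-neighbor process $(X_n)_{n\ge0}$ with $X_0=x$ which, on its $i$-th visit to site $z$, jumps to $z+1$ with probability $\omega(z,i)$ and to $z-1$ otherwise. Annealed measure $P_x[\cdot]=\mathbb E[P_{x,\omega}[\cdot]]$. *)

(* Defs.v *)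
From HB Require Import structures.
From mathcomp Require Import all_boot all_order all_algebra.
From mathcomp Require Import all_classical all_reals all_analysis measurable_realfun.
Set Implicit Arguments. Unset Strict Implicit. Unset Printing Implicit Defensive.
Import Order.TTheory GRing.Theory Num.Theory.
Import numFieldTopology.Exports numFieldNormedType.Exports.
Local Open Scope classical_set_scope.
Local Open Scope ring_scope.

(* Cookie environments.  An environment is w : int -> nat -> R, where      *)
(* w z i (for i >= 1) is the probability of a right jump on the i-th      *)
(* visit to site z (paper's omega(z,i)).  The value w z 0 is unused.      *)

(* int needs a point for the (pointed) function types below *)
HB.instance Definition _ := isPointed.Build int 0.
Definition EnvCarrier (R : realType) := int -> nat -> R.
Definition SeqCarrier (R : realType) := nat -> nat -> R.
Definition PathCarrier := nat -> int.

Definition env_gen (R : realType) : set (set (EnvCarrier R)) :=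
  [set A | exists z i (B : set R), measurable B /\ A = (fun w => w z i) @^-1` B].
Definition Env (R : realType) := g_sigma_algebraType (@env_gen R).

Definition seq_gen (R : realType) : set (set (SeqCarrier R)) :=
  [set A | exists x i (B : set R), measurable B /\ A = (fun s => s x i) @^-1` B].
Definition EnvSeq (R : realType) := g_sigma_algebraType (@seq_gen R).

Definition env_nonneg (R : realType) (w : Env R) : EnvSeq R :=
  fun x i => w (Posz x) i.
Definition seq_shift (R : realType) (s : EnvSeq R) : EnvSeq R :=
  fun x => s x.+1.

Definition Omega_plus (R : realType) : set (Env R) :=
  [set w | forall (z : int) (i : nat), (1 <= i)%N -> 2^-1 <= w z i <= 1].

Definition stationary_nonneg (R : realType) (P : probability (Env R) R) :=
  forall B : set (EnvSeq R), measurable B ->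
    P (env_nonneg (R:=R) @^-1` B) =
    P (env_nonneg (R:=R) @^-1` (seq_shift (R:=R) @^-1` B)).

Definition ergodic_nonneg (R : realType) (P : probability (Env R) R) :=
  forall B : set (EnvSeq R), measurable B ->
    seq_shift (R:=R) @^-1` B = B ->
    P (env_nonneg (R:=R) @^-1` B) = 0%E \/ P (env_nonneg (R:=R) @^-1` B) = 1%E.

Definition path_gen : set (set PathCarrier) :=
  [set A | exists (n : nat) (z : int), A = [set p | p n = z]].
Definition Path := g_sigma_algebraType path_gen.

(* number of visits to s k among times 0..k (so the current visit counts) *)
Definition nvisits (s : nat -> int) (k : nat) : nat :=
  count (fun j => s j == s k) (iota 0 k.+1).

Definition step_prob (R : realType) (w : Env R) (s : nat -> int) (k : nat) : R :=
  if s k.+1 == s k + 1 then w (s k) (nvisits s k)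
  else if s k.+1 == s k - 1 then 1 - w (s k) (nvisits s k)
  else 0.

Definition prefix_prob (R : realType) (w : Env R) (s : nat -> int) (n : nat) : R :=
  if s 0%N == 0 then \prod_(k < n) step_prob w s k else 0.

(* Q is the law P_{0,w} of the cookie random walk started at 0 in w:
   all finite-dimensional cylinder probabilities are the prescribed ones
   (this determines Q uniquely on the product sigma-algebra). *)
Definition is_quenched_law (R : realType) (w : Env R) (Q : probability Path R) :=
  forall (n : nat) (s : nat -> int),
    Q [set p : Path | forall k, (k <= n)%N -> p k = s k] = (prefix_prob w s n)%:E.

Definition speed_zero (R : realType) : set Path :=
  [set p : Path | (fun n : nat => ((p n)%:~R / n%:R : R)) @ \oo --> (0 : R)].

(* Main.v *)
Require Import Defs.
From HB Require Import structures.
From mathcomp Require Import all_boot all_order all_algebra.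
From mathcomp Require Import all_classical all_reals all_analysis measurable_realfun.
From mathcomp Require Import zify ring lra.
Set Implicit Arguments. Unset Strict Implicit. Unset Printing Implicit Defensive.
Import Order.TTheory GRing.Theory Num.Theory.
Import numFieldTopology.Exports numFieldNormedType.Exports.
Local Open Scope classical_set_scope.
Local Open Scope ring_scope.

(** Since every cookie is at least 1/2, [X_n] is a submartingale with bounded
increments, so [liminf X_n / n >= 0] by Azuma's inequality.  For the upper bound,
let [T_M] be the first hitting time of [M].  If the first jumps from both [M - 1]
and [M] go left, then at time [T_M + 1] the walk stands on [M - 1], which has no
cookie left, and each site below has at most one cookie left (its second one).
Even if all those cookies have strength 1, the walk reaches depth [d] with
probability of order [1 / d^2] and then spends time of order [d^2] there, so each
scale contributes equally and the expected return time from a dive cut off at depth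
[L] is of order [log L].
By ergodicity a positive fraction of the pairs [(x, x + 1)] have first cookies
[<= 1 - eta], so that Azuma's inequality for a suitable potential bounds the speed
by a constant times [1 / log L], for every [L]. *)

(** * The walk and its state *)

(* A path of length n is encoded by the list of its n steps, latest first (true = right). *)
Fixpoint pos (bs : seq bool) : int :=
  if bs is b :: bs' then (if b then pos bs' + 1 else pos bs' - 1) else 0.

Fixpoint visits (z : int) (bs : seq bool) : nat :=
  ((pos bs == z) + if bs is _ :: bs' then visits z bs' else 0)%N.

(* With M = rmax the maximum so far: depth = M - (current position); explored = largest
   depth visited since T_M, the current time excluded (at least 1 by convention);
   detour: the first jump from M - 1 went left; fresh: the current time is T_M. *)
Record state := State {
  rmax : nat; depth : nat; explored : nat; detour : bool; fresh : bool }.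

(** [explored] leaves out the current time, so each step first merges the current depth into it. At
    a new maximum, [detour] becomes [~~ fresh s]: the first jump from the old maximum went left
    exactly when that maximum was already stale. *)
Definition step_state (b : bool) (s : state) : state :=
  let D := maxn (explored s) (depth s) in
  if b then
    if depth s == 0%N then State (rmax s).+1 0 1 (~~ fresh s) true
    else State (rmax s) (depth s).-1 D (detour s) false
  else State (rmax s) (depth s).+1 D (detour s) false.

Definition walk_state (bs : seq bool) : state :=
  foldr step_state (State 0 0 1 false true) bs.

(* The point is inv_visits_explored: on return to an explored depth the walk makes at least
   its third visit to the site, hence jumps with probability 1/2. *)
Record state_inv (bs : seq bool) (s : state) : Prop := StateInv {
  inv_pos : pos bs = (rmax s)%:Z - (depth s)%:Z;
  inv_explored : (1 <= explored s)%N;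
  inv_depth : (depth s <= (explored s).+1)%N;
  inv_fresh : fresh s -> depth s = 0%N;
  inv_fresh_explored : fresh s -> explored s = 1%N;
  inv_above : forall z : int, (rmax s)%:Z < z -> visits z bs = 0%N;
  inv_visits_fresh : fresh s -> visits (rmax s)%:Z bs = 1%N;
  inv_visits_stale : ~~ fresh s -> ((depth s == 0%N).+1 <= visits (rmax s)%:Z bs)%N;
  inv_visits_below : forall k, (1 <= k <= rmax s)%N ->
    ((depth s == k).+1 <= visits ((rmax s)%:Z - k%:Z) bs)%N;
  inv_visits_explored : forall k, (1 <= k <= rmax s)%N -> (k <= explored s)%N ->
    (2 <= k)%N || detour s -> ((depth s == k).+2 <= visits ((rmax s)%:Z - k%:Z) bs)%N }.

Lemma walk_state_inv (bs : seq bool) : state_inv bs (walk_state bs).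
Proof.
elim: bs => [|b bs].
  split=> //=; try by move=> k; lia.
change (walk_state (b :: bs)) with (step_state b (walk_state bs)).
case: (walk_state bs) => M d D b1 f [/= ip iD id ifr ifD ia ivf ivs ivb ive].
rewrite /step_state /=.
case: b => /=; [case: eqP => [d0|/eqP d0]|]; split=> //=; rewrite ?ip.
all: try lia.
- move=> z hz; rewrite ia; lia.
- move=> _; rewrite ia; lia.
- move=> k hk.
  case: (ltnP 1 k) => k1.
    have := ivb k.-1; have -> : M%:Z - k.-1%:Z = M.+1%:Z - k%:Z by lia.
    move=> /(_ ltac:(lia)). lia.
  have -> : k = 1%N by lia.
  have -> : M.+1%:Z - 1%:Z = M%:Z by lia.
  case: f ifr ifD ivf ivs => ifr ifD ivf ivs; [have := ivf isT | have := ivs isT]; lia.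
(* After the reset only depth 1, the old maximum, counts as explored; a detour means that it was
   left and revisited, so it has two visits. *)
- move=> k hk k1; have -> : k = 1%N by lia.
  have -> : M.+1%:Z - 1%:Z = M%:Z by lia.
  move=> /= nf; have := ivs nf; lia.
- move=> z hz; rewrite ia; lia.
- move=> k hk; have := ivb k hk; lia.
(* If [k > D], then [k] is the depth being left, where [ivb] already counts two visits. *)
- move=> k hk hkD h; have := ivb k hk; case: (leqP k D) => hk1; last by lia.
  have := ive k hk hk1 h; lia.
- move=> z hz; rewrite ia; lia.
- move=> k hk; have := ivb k hk; lia.
- move=> k hk hkD h; have := ivb k hk; case: (leqP k D) => hk1; last by lia.
  have := ive k hk hk1 h; lia.
Qed.

(** * The excursion potential *)

Section ExcursionPotential.
Variables (R : realFieldType) (L : nat).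
Hypothesis L_gt0 : (0 < L)%N.

Definition harmonic_tail (m : nat) : R := \sum_(m <= j < L) j%:R^-1.

(** Solution of [edge_rec], by which [edge D / D] drops by [2 / D] when [D] grows by one, with
    boundary value [2 L] at depth [L]. *)
Definition edge (D : nat) : R :=
  (minn D L)%:R * (2 + 2 * harmonic_tail (minn D L)).

(* A lower bound for the return time from depth d when the depths up to D are explored: it is
   the expected exit time d (e - d) of simple random walk from (0, e) with e = edge D, where
   edge_rec makes the drift exactly -1 in the worst case, a cookie of strength 1 at the
   frontier depth D + 1. *)
Definition excursion (d D : nat) : R :=
  (minn d L)%:R * (edge D - (minn d L)%:R).

Lemma harmonic_tail_ge0 m : 0 <= harmonic_tail m.
Proof. by apply: sumr_ge0 => j _; rewrite invr_ge0 ler0n. Qed.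

Lemma edge_ge D : (minn D L)%:R *+ 2 <= edge D.
Proof.
rewrite /edge -mulr_natr ler_wpM2l ?ler0n// lerDl.
by rewrite mulr_ge0// harmonic_tail_ge0.
Qed.

Lemma edge_saturated D : (L <= D)%N -> edge D = L%:R *+ 2.
Proof.
move=> /minn_idPr; rewrite /edge => ->.
by rewrite /harmonic_tail big_geq// mulr0 addr0 mulr_natr.
Qed.

Lemma edge_rec D : (0 < D)%N -> (D < L)%N ->
  D.+1%:R * edge D = D%:R * edge D.+1 + 2 * D.+1%:R.
Proof.
move=> D0 DL; rewrite /edge (minn_idPl (ltnW DL)) (minn_idPl DL).
have -> : harmonic_tail D = D%:R^-1 + harmonic_tail D.+1 by rewrite /harmonic_tail big_ltn.
have : D%:R != 0 :> R by rewrite pnatr_eq0 -lt0n.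
by move=> ?; field.
Qed.

Lemma excursion0 D : excursion 0 D = 0.
Proof. by rewrite /excursion min0n mul0r. Qed.

Lemma excursion_ge0 d D : (0 < D)%N -> (d <= D.+1)%N -> 0 <= excursion d D.
Proof.
move=> D0 dD; rewrite /excursion mulr_ge0 ?ler0n// subr_ge0.
apply: le_trans (edge_ge D); rewrite -mulrnA ler_nat; lia.
Qed.

(** Crude: each term of the harmonic tail is replaced by 1. Only independence of the state matters,
    since Azuma's inequality needs bounded increments. *)
Definition excursion_bound : R := L%:R * (L%:R * (2 + 2 * L%:R)).

Lemma excursion_le d D : (0 < D)%N -> excursion d D <= excursion_bound.
Proof.
move=> D0; have hL : (minn d L)%:R <= L%:R :> R by rewrite ler_nat geq_minr.
have edge_bound : edge D <= L%:R * (2 + 2 * L%:R).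
  rewrite /edge ler_pM ?ler0n ?ler_nat ?geq_minr//.
    by rewrite addr_ge0// mulr_ge0// harmonic_tail_ge0.
  rewrite lerD2l ler_wpM2l//.
  apply: (@le_trans _ _ (\sum_(minn D L <= j < L) 1)); last first.
    by rewrite big_const_nat iter_addr_0 ler_nat leq_subr.
  rewrite /harmonic_tail big_nat_cond [leRHS]big_nat_cond; apply: ler_sum => j.
  rewrite andbT => /andP[hj _]; rewrite invf_le1 ?ltr0n; [rewrite ler1n; lia|lia].
apply: (@le_trans _ _ (L%:R * edge D)); last by rewrite ler_wpM2l ?ler0n.
have e0 : 0 <= edge D.
  by apply: le_trans (edge_ge D); rewrite mulrn_wge0 ?ler0n.
rewrite /excursion; have : 0 <= (minn d L)%:R :> R by rewrite ler0n.
by move: (minn d L)%:R hL => a; nra.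
Qed.

Lemma excursion_bound_ge0 : 0 <= excursion_bound.
Proof. by rewrite !mulr_ge0 ?addr_ge0 ?mulr_ge0 ?ler0n. Qed.

(** The credit on stepping left from a fresh maximum to depth 1 after a detour; by [gainE] it grows
    like [2 log L]. *)
Definition gain : R := excursion 1 1.

Lemma gain_ge0 : 0 <= gain. Proof. exact: excursion_ge0. Qed.

Lemma gain_le : gain <= excursion_bound. Proof. exact: excursion_le. Qed.

Lemma gainE : gain = 1 + 2 * harmonic_tail 1.
Proof.
rewrite /gain /excursion /edge (minn_idPl L_gt0); lra.
Qed.

(** Among explored depths the edge [e] stays constant, and [d (e - d)] has second difference -2, so
    a fair jump loses exactly 1. *)
Lemma excursion_drift_exhausted d D : (0 < d)%N -> (d < L)%N -> (d <= D)%N ->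
  excursion d D - 1 <=
    2^-1 * excursion d.-1 (maxn D d) + (1 - 2^-1) * excursion d.+1 (maxn D d).
Proof.
case: d => // d _ dL dD; rewrite (maxn_idPl dD) /excursion.
rewrite (minn_idPl (ltnW dL)) (minn_idPl dL) /= (minn_idPl (ltnW (ltnW dL))).
by move: (edge D) => e; rewrite -[d.+2%:R]natr1 -[d.+1%:R]natr1; nra.
Qed.

(** The cookie may have any strength here, even [p = 1]; the inequality therefore has to hold after
    each of the two jumps separately. *)
Lemma excursion_drift_frontier d D (p : R) : (1 < d)%N -> (d <= D.+1)%N ->
  (d == D.+1) || (L <= d)%N -> 2^-1 <= p <= 1 ->
  excursion d D - 1 <=
    p * excursion d.-1 (maxn D d) + (1 - p) * excursion d.+1 (maxn D d).
Proof.
case: d => [//|d]; rewrite ltnS => d0 dD hd /andP[p1 p2].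
case: (leqP L d.+1) => [Ld|dL].
  (* After the step the edge is [2 L], and [a (2 L - a)] peaks at [a = L] with value [L^2] and is
     smaller by only 1 at [a = L - 1]. *)
  rewrite /excursion (minn_idPr Ld) (minn_idPr (leqW Ld)) /=.
  rewrite (@edge_saturated (maxn D d.+1)); last by lia.
  have e1 : L%:R * (edge D - L%:R) <= L%:R * L%:R :> R.
    case: (leqP L D) => LD; first by rewrite edge_saturated// mulr2n addrK.
    have DL : L = D.+1 by lia.
    have := @edge_rec D; rewrite -DL leqnn => /(_ ltac:(lia) isT).
    rewrite (@edge_saturated L)// => h.
    have : D%:R = L%:R - 1 :> R by rewrite DL -natr1 addrK.
    by move=> hD; rewrite hD in h; rewrite mulrBr; nra.
  have e2 : L%:R * L%:R - 1 <= (minn d L)%:R * (L%:R *+ 2 - (minn d L)%:R) :> R.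
    have : (L <= (minn d L).+1)%N by lia.
    have : (minn d L <= L)%N by lia.
    rewrite -!(ler_nat R) -natr1 mulr2n; move: (minn d L)%:R L%:R => a b h1 h2.
    have : 0 <= (b - a) * (1 - (b - a)) by rewrite mulr_ge0; lra.
    lra.
  have -> : L%:R *+ 2 - L%:R = L%:R :> R by rewrite mulr2n addrK.
  move: e1 e2.
  move: (L%:R * (_ - _)) ((minn d L)%:R * _) (L%:R * L%:R) => x y z h1 h2.
  have : 0 <= p * (y - (z - 1)) by rewrite mulr_ge0; lra.
  nra.
have dD' : d = D by lia.
subst D; rewrite /excursion (maxn_idPr (leqnSn d)) (minn_idPl (ltnW dL)) (minn_idPl dL) /=.
rewrite (minn_idPl (ltnW (ltnW dL))).
have := @edge_rec d d0 (ltnW dL); have := edge_ge d.+1; rewrite (minn_idPl (ltnW dL)).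
move: (edge d) (edge d.+1) => e f; rewrite -[d.+2%:R]natr1 -[d.+1%:R]natr1.
have : 0 < d%:R :> R by rewrite ltr0n.
move: (d%:R) => x x0 h1 h2.
(* By [edge_rec] a right jump from the frontier costs exactly 1; a left jump does no worse because
   [f >= 2 (x + 1)]. *)
have -> : (x + 1) * (e - (x + 1)) - 1 = x * (f - x) by rewrite mulrBr h2; ring.
suff : 0 <= (1 - p) * ((x + 1 + 1) * (f - (x + 1 + 1)) - x * (f - x)) by lra.
rewrite mulr_ge0; lra.
Qed.

End ExcursionPotential.

(** * The time potential *)

Definition jump_prob (R : realFieldType) (w : int -> nat -> R) (bs : seq bool) : R :=
  w (pos bs) (visits (pos bs) bs).

Lemma visits_pos_gt0 bs : (0 < visits (pos bs) bs)%N.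
Proof. by case: bs => [//|b bs] /=; rewrite eqxx. Qed.

Section TimePotential.
Variables (R : realFieldType) (w : int -> nat -> R) (L : nat) (eta : R).
Hypothesis L_gt1 : (1 < L)%N.
Hypothesis w_range : forall (z : int) (i : nat), (0 < i)%N -> 2^-1 <= w z i <= 1.
Hypothesis w_cookies : forall (x i : nat), (2 < i)%N -> w x%:Z i = 2^-1.
Hypothesis eta_range : 0 <= eta <= 1.

Definition soft (x : nat) : bool := w x%:Z 1 <= 1 - eta.
Definition soft_pair (x : nat) : bool := soft x && soft x.+1.
(** [L <= M] keeps depths up to [L] on nonnegative sites, where [w_cookies] applies. *)
Definition late_pair (M : nat) : bool := (L <= M)%N && soft_pair M.-1.
Definition late_pairs (M : nat) : nat := \sum_(x < M) late_pair x.+1.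

Local Notation G := (gain R L).
Local Notation B := (excursion_bound R L).

(* The coefficients eta * gain and (eta - eta^2) * gain prepay, for a late pair (M - 1, M), the
   expected gain eta^2 * gain: each of the two left jumps has probability at least eta. *)
Definition bonus (s : state) : R :=
  if fresh s then eta * G *+ (detour s && late_pair (rmax s))
  else excursion R L (depth s) (explored s) *+ (detour s && (L <= rmax s)%N)
       + (eta - eta ^+ 2) * G *+ late_pair (rmax s).+1.

(** Elapsed time plus current credit, minus the gain guaranteed by each late pair up to the maximum.
    As a submartingale it forces time to grow at least like [eta^2 * gain] times the number of late
    pairs. *)
Definition time_potential (bs : seq bool) : R :=
  (size bs)%:R + bonus (walk_state bs)
  - eta ^+ 2 * G * (late_pairs (rmax (walk_state bs)))%:R.

Let L_gt0 : (0 < L)%N := ltnW L_gt1.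
Let G_ge0 : 0 <= G := gain_ge0 R L_gt0.
Let G_le : G <= B := gain_le R L_gt0.

Let eta_sub_ge0 : 0 <= eta - eta ^+ 2.
Proof. by have [e0 e1] := andP eta_range; rewrite subr_ge0 expr2 ler_piMr. Qed.

Lemma bonus_ge0 s : (0 < explored s)%N -> (depth s <= (explored s).+1)%N -> 0 <= bonus s.
Proof.
have [e0 e1] := andP eta_range.
move=> D0 dD; rewrite /bonus; case: ifP => _.
  by rewrite mulrn_wge0// mulr_ge0.
by rewrite addr_ge0// mulrn_wge0 ?excursion_ge0// mulr_ge0// eta_sub_ge0.
Qed.

Lemma bonus_le s : (0 < explored s)%N -> bonus s <= B *+ 2.
Proof.
have [e0 e1] := andP eta_range.
have B0 : 0 <= B := excursion_bound_ge0 R L.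
have hx x (b : bool) : x <= B -> x *+ b <= B by case: b; rewrite ?mulr1n ?mulr0n.
move=> D0; rewrite /bonus mulr2n; case: ifP => _.
  rewrite ler_wpDr//; apply: (hx); apply: le_trans G_le; rewrite ler_piMl//.
rewrite lerD// hx//; first exact: excursion_le.
apply: le_trans G_le; rewrite ler_piMl//.
nra.
Qed.

Lemma late_pairsS M : late_pairs M.+1 = (late_pairs M + late_pair M.+1)%N.
Proof. by rewrite /late_pairs big_ord_recr. Qed.

(** One step adds 1 to the time, moves [bonus] within [[0, 2 B]] and records at most one late pair,
    worth at most [B]. *)
Lemma time_potential_increment b bs :
  `|time_potential (b :: bs) - time_potential bs| <= 1 + 3 * B.
Proof.
have [e0 e1] := andP eta_range.
have B0 : 0 <= B := excursion_bound_ge0 R L.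
have [_ D0 dD _ _ _ _ _ _ _] := walk_state_inv bs.
have [_ D0' dD' _ _ _ _ _ _ _] := walk_state_inv (b :: bs).
have := bonus_ge0 D0 dD; have := bonus_ge0 D0' dD'.
have := bonus_le D0; have := bonus_le D0'.
rewrite /time_potential /= -natr1.
have -> : eta ^+ 2 * G * (late_pairs (rmax (step_state b (walk_state bs))))%:R =
  eta ^+ 2 * G * (late_pairs (rmax (walk_state bs)))%:R +
  eta ^+ 2 * G * ((rmax (step_state b (walk_state bs)) != rmax (walk_state bs)) &&
     late_pair (rmax (walk_state bs)).+1)%:R.
  rewrite /step_state; case: b {D0' dD'}; last by rewrite eqxx mulr0 addr0.
  case: ifP => _ /=; last by rewrite eqxx mulr0 addr0.
  by rewrite late_pairsS natrD mulrDr gtn_eqF.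
set c := _ && _; have : 0 <= eta ^+ 2 * G * c%:R <= B.
  have e2 : 0 <= eta ^+ 2 <= 1 by apply/andP; split; nra.
  have c2 : 0 <= (c%:R : R) <= 1 by case: (c); rewrite ?lexx ler01.
  have [[e20 e21] [c0 c1]] := (andP e2, andP c2).
  have GG : 0 <= eta ^+ 2 * G by exact: mulr_ge0.
  rewrite mulr_ge0//=; apply: le_trans G_le.
  by apply: le_trans (ler_piMr _ _) (ler_piMl _ _).
move=> /andP[]; move: (eta ^+ 2 * G * c%:R) => u.
by move: (eta ^+ 2 * G * _) => v h1 h2 h3 h4 h5 h6; rewrite ler_norml; apply/andP; split; lra.
Qed.

Lemma jump_prob_range bs : 2^-1 <= jump_prob w bs <= 1.
Proof. by apply: w_range; exact: visits_pos_gt0. Qed.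

Lemma time_potential_drift bs :
  time_potential bs <= jump_prob w bs * time_potential (true :: bs)
    + (1 - jump_prob w bs) * time_potential (false :: bs).
Proof.
have [e0 e1] := andP eta_range.
have hp := jump_prob_range bs; have [p1 p2] := andP hp.
have [ip iD id ifr ifD _ ivf ivs ivb ive] := walk_state_inv bs.
rewrite /time_potential [walk_state (true :: _)]/= [walk_state (false :: _)]/=.
case: (walk_state bs) ip iD id ifr ifD ivf ivs ivb ive => M d D b1 f /=.
move=> ip iD id ifr ifD ivf ivs ivb ive; rewrite /step_state /= -natr1.
case: f ifr ifD ivf ivs => [/(_ isT) d0 /(_ isT) D1 /(_ isT) ivf _|_ _ _ /(_ isT) ivs].
  subst d D; rewrite eqxx /= /bonus /= late_pairsS natrD maxn0.
  (* At time [T_M] the first cookie of [M] is used, so if [M] is soft the walk goes left with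
     probability at least [eta]. This pays for the pair [(M, M + 1)] in [r0] and for [(M - 1, M)] in
     [c0]. *)
  have hpM : jump_prob w bs = w M%:Z 1 by rewrite /jump_prob ip subr0 ivf.
  have hsoft : late_pair M.+1 -> eta <= 1 - jump_prob w bs.
    by rewrite hpM; case/and3P => _ h _; move: h; rewrite /soft; lra.
  have hsoft' : b1 && late_pair M -> eta <= 1 - jump_prob w bs.
    rewrite hpM; case/and4P => _ LM _; rewrite /soft prednK; [lra|lia].
  have hLM : b1 && late_pair M -> b1 && (L <= M)%N by case/and3P => -> ->.
  have r0 : 0 <= G * eta * (late_pair M.+1)%:R * (1 - jump_prob w bs - eta).
    case: (late_pair M.+1) hsoft => [/(_ isT) h|_]; last by rewrite mulr0 mul0r.
    by rewrite mulr1; apply: mulr_ge0; [exact: mulr_ge0|rewrite subr_ge0].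
  have c0 : 0 <= G * (b1 && late_pair M)%:R * (1 - jump_prob w bs - eta).
    case: (b1 && _) hsoft' => [/(_ isT) h|_]; last by rewrite mulr0 mul0r.
    by rewrite mulr1; apply: mulr_ge0; [|rewrite subr_ge0].
  have cc' : 0 <= (1 - jump_prob w bs) *
      (G * ((b1 && (L <= M)%N)%:R - (b1 && late_pair M)%:R)).
    apply: mulr_ge0; first by rewrite subr_ge0.
    apply: mulr_ge0 => //; rewrite subr_ge0 ler_nat.
    by case: (b1 && late_pair M) hLM => // /(_ isT) ->.
  rewrite -/(gain R L) -(mulr_natr (eta * G)) -(mulr_natr G) -(mulr_natr ((eta - eta ^+ 2) * G)).
  move: (jump_prob w bs) (late_pair M.+1)%:R (b1 && late_pair M)%:R
    (b1 && (L <= M)%N)%:R (late_pairs M)%:R (size bs)%:R r0 c0 cc' => p r c c' N n.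
  by lra.
set p := jump_prob w bs in hp p1 p2 *.
case: eqP => [d0|/eqP]; last rewrite -lt0n => d0.
  (* At a stale maximum a right jump trades the prepaid [(eta - eta^2) * gain] for a bonus
     [eta * gain] and a recorded [- eta^2 * gain], without loss. *)
  subst d; rewrite /bonus /= late_pairsS natrD (maxn_idPl (leq0n D)) excursion0.
  rewrite mul0rn add0r -(mulr_natr ((eta - eta ^+ 2) * G)) -(mulr_natr (eta * G)) -(mulr_natr (excursion _ _ _ _)).
  have c0 : 0 <= (1 - p) * (excursion R L 1 D * (b1 && (L <= M)%N)%:R).
    apply: mulr_ge0; first by rewrite subr_ge0.
    by apply: mulr_ge0 => //; exact: excursion_ge0.
  move: (excursion _ _ _ _ * _) (late_pair M.+1)%:R (late_pairs M)%:R (size bs)%:R c0.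
  move=> e r N n c0.
  by lra.
rewrite /bonus /=.
suff : excursion R L d D *+ (b1 && (L <= M)%N) - 1 <=
   p * (excursion R L d.-1 (maxn D d) *+ (b1 && (L <= M)%N))
   + (1 - p) * (excursion R L d.+1 (maxn D d) *+ (b1 && (L <= M)%N)) by lra.
case: (boolP (b1 && _)) => [/andP[b1T LM]|_]; last by rewrite !mulr0n; lra.
(* An explored depth below [L] is at least on its third visit, so [p = 1/2]; otherwise the depth is
   [D + 1] or at least [L]. *)
rewrite !mulr1n; case: (boolP ((d < L)%N && (d <= D)%N)) => [/andP[dL dD]|hd].
  suff -> : p = 2^-1 by apply: excursion_drift_exhausted.
  rewrite /p /jump_prob ip; have := ive d _ dD; rewrite b1T orbT eqxx.
  have -> : M%:Z - d%:Z = (M - d)%N%:Z by lia.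
  by move=> h; apply: w_cookies; apply: h => //; lia.
by apply: excursion_drift_frontier => //; lia.
Qed.

End TimePotential.

(** * Azuma inequality for the walk *)

Fixpoint path_weight (R : realFieldType) (w : int -> nat -> R) (bs : seq bool) : R :=
  if bs is b :: bs' then
    (if b then jump_prob w bs' else 1 - jump_prob w bs') * path_weight w bs'
  else 1.

Fixpoint all_steps (n : nat) : seq (seq bool) :=
  if n is n'.+1 then
    [seq true :: bs | bs <- all_steps n'] ++ [seq false :: bs | bs <- all_steps n']
  else [:: [::]].

Lemma size_all_steps n bs : bs \in all_steps n -> size bs = n.
Proof.
elim: n bs => [|n IH] bs /=; first by rewrite inE => /eqP ->.
by rewrite mem_cat => /orP[] /mapP[bs' /IH <- ->].
Qed.

Lemma mem_all_steps bs : bs \in all_steps (size bs).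
Proof.
elim: bs => [//|[] bs IH] /=; rewrite mem_cat; apply/orP; [left|right]; exact: map_f.
Qed.

Section Weights.
Variables (R : realFieldType) (w : int -> nat -> R).
Hypothesis w_range : forall (z : int) (i : nat), (0 < i)%N -> 2^-1 <= w z i <= 1.

Lemma path_weight_ge0 bs : 0 <= path_weight w bs.
Proof.
elim: bs => //= b bs IH; have := jump_prob_range w_range bs.
by move=> h; rewrite mulr_ge0//; case: b; lra.
Qed.

Lemma sum_all_stepsS n (F : seq bool -> R) :
  \sum_(bs <- all_steps n.+1) F bs =
  \sum_(bs <- all_steps n) (F (true :: bs) + F (false :: bs)).
Proof. by rewrite big_cat /= !big_map big_split. Qed.

(** The sum is the expectation of [Z] at time [n]; conditioning on the first [n] steps, the next one
    multiplies it by at most [r]. *)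
Lemma supermartingale_bound (Z : seq bool -> R) (r : R) :
  0 <= r ->
  (forall bs, jump_prob w bs * Z (true :: bs) + (1 - jump_prob w bs) * Z (false :: bs)
     <= r * Z bs) ->
  forall n, \sum_(bs <- all_steps n) path_weight w bs * Z bs <= r ^+ n * Z [::].
Proof.
move=> r0 hZ; elim=> [|n IH]; first by rewrite big_seq1 /= expr0.
rewrite sum_all_stepsS exprS -mulrA.
apply: le_trans (ler_wpM2l r0 IH); rewrite mulr_sumr; apply: ler_sum => bs _ /=.
have := ler_wpM2l (path_weight_ge0 bs) (hZ bs); lra.
Qed.
End Weights.

(** From [1 - u <= exp(-u)] follows [exp(u) (1 - u) <= 1], while [(1 + u + 2 u^2) (1 - u) = 1 + u^2
    (1 - 2 u) >= 1]. *)
Lemma expR_le_quadratic (R : realType) (u : R) : u <= 2^-1 -> expR u <= 1 + u + 2 * u ^+ 2.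
Proof.
move=> u2; have h := expR_ge1Dx (- u); have e0 := expR_gt0 u.
have := expRxMexpNx_1 u; move: (expR u) (expR (- u)) h e0 => a b h e0 ab.
have h1 : a * (1 - u) <= 1 by have := ler_wpM2l (ltW e0) h; rewrite ab.
have h2 : 1 <= (1 + u + 2 * u ^+ 2) * (1 - u).
  have -> : (1 + u + 2 * u ^+ 2) * (1 - u) = 1 + u ^+ 2 * (1 - 2 * u) by ring.
  by rewrite lerDl mulr_ge0 ?sqr_ge0//; lra.
have u1 : 0 < 1 - u by lra.
by rewrite -(ler_pM2r u1); exact: le_trans h1 h2.
Qed.

Section Azuma.
Variables (R : realType) (w : int -> nat -> R) (Y : seq bool -> R) (C : R).
Hypothesis w_range : forall (z : int) (i : nat), (0 < i)%N -> 2^-1 <= w z i <= 1.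
Hypothesis C_ge1 : 1 <= C.
Hypothesis Y_increment : forall b bs, `|Y (b :: bs) - Y bs| <= C.
Hypothesis Y_drift : forall bs,
  Y bs <= jump_prob w bs * Y (true :: bs) + (1 - jump_prob w bs) * Y (false :: bs).

(** The drift hypothesis makes the linear term of the expansion nonpositive, so only the quadratic
    one remains. *)
Lemma exp_moment_step (l : R) bs : 0 <= l -> l * C <= 2^-1 ->
  jump_prob w bs * expR (- l * Y (true :: bs))
  + (1 - jump_prob w bs) * expR (- l * Y (false :: bs))
  <= (1 + 2 * (l * C) ^+ 2) * expR (- l * Y bs).
Proof.
move=> l0 lC.
have step b : expR (- l * Y (b :: bs)) <=
    (1 - l * (Y (b :: bs) - Y bs) + 2 * (l * C) ^+ 2) * expR (- l * Y bs).
  have -> : - l * Y (b :: bs) = - l * (Y (b :: bs) - Y bs) + - l * Y bs by ring.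
  rewrite expRD ler_wpM2r ?expR_ge0//.
  have := Y_increment b bs; rewrite ler_norml; move: (_ - _) => D /andP[D1 D2].
  apply: le_trans (expR_le_quadratic _) _; first by nra.
  rewrite mulNr lerD2l sqrrN ler_wpM2l// !exprMn ler_wpM2l ?sqr_ge0//.
  by nra.
have := jump_prob_range w_range bs => /andP[p1 p2].
have p0 : 0 <= jump_prob w bs by lra.
have q0 : 0 <= 1 - jump_prob w bs by lra.
apply: le_trans (lerD (ler_wpM2l p0 (step true)) (ler_wpM2l q0 (step false))) _.
rewrite !mulrA -mulrDl ler_wpM2r ?expR_ge0//.
have := ler_wpM2l l0 (Y_drift bs).
move: (jump_prob w bs) (Y (true :: bs)) (Y (false :: bs)) (Y bs) => p a b c.
by move: ((l * C) ^+ 2) => e; lra.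
Qed.

Lemma azuma_tail (d : R) : 0 < d <= 1 -> exists r A : R, [/\ 0 <= r < 1, 0 <= A &
  forall n, \sum_(bs <- all_steps n | Y bs <= - d * n%:R) path_weight w bs <= A * r ^+ n].
Proof.
(* This [l] gives [2 (l C)^2 = l d / 2], so the growth factor [1 + l d / 2] loses against [exp(l d)]
   and [r < 1]. *)
move=> /andP[d0 d1]; pose l := d / (4 * C ^+ 2).
have C0 : 0 < C := lt_le_trans ltr01 C_ge1.
have l0 : 0 < l by rewrite divr_gt0 ?mulr_gt0 ?exprn_gt0.
have lCC : l * C ^+ 2 = d / 4 by rewrite /l; field; rewrite gt_eqF.
have lC : l * C <= 2^-1.
  have := ler_wpM2l (ltW (mulr_gt0 l0 C0)) C_ge1; rewrite mulr1 -mulrA -expr2 lCC.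
  by move: (l * C) => x; lra.
pose r := (1 + 2 * (l * C) ^+ 2) * expR (- (l * d)).
exists r, (expR (- l * Y [::])).
have a0 : 0 <= 1 + 2 * (l * C) ^+ 2 by rewrite addr_ge0// mulr_ge0// sqr_ge0.
have r0 : 0 <= r by rewrite mulr_ge0// expR_ge0.
split; [|exact: expR_ge0|].
  rewrite r0 /= /r expRN ltr_pdivrMr ?expR_gt0// mul1r.
  apply: (lt_le_trans _ (expR_ge1Dx _)); rewrite ltrD2l.
  have -> : 2 * (l * C) ^+ 2 = l * (2 * (l * C ^+ 2)) by ring.
  by rewrite lCC ltr_pM2l//; move: d0; lra.
move=> n.
have := @supermartingale_bound R w w_range (fun bs => expR (- l * Y bs)) _ a0
  (fun bs => exp_moment_step bs (ltW l0) lC) n.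
move=> h; rewrite /r exprMn mulrA -expRM_natl.
have -> : n%:R * - (l * d) = - (l * (d * n%:R)) by ring.
rewrite expRN ler_pdivlMr ?expR_gt0// [X in _ <= X]mulrC; apply: le_trans h.
(* Markov's inequality: on the event, [exp(- l Y)] is at least [exp(l d n)]. *)
rewrite mulr_suml big_mkcond /=; apply: ler_sum => bs _.
case: ifP => hY; last by rewrite mulr_ge0 ?expR_ge0// path_weight_ge0.
rewrite ler_wpM2l ?path_weight_ge0// ler_expR; nra.
Qed.

End Azuma.

(** * The quenched law on path space *)

(** Every step other than +1 is recorded as left, so the encoding is faithful only on
    nearest-neighbour paths, which have full measure. *)
Fixpoint steps (p : nat -> int) (n : nat) : seq bool :=
  if n is n'.+1 then (p n == p n' + 1) :: steps p n' else [::].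

(** The latest step comes first, so dropping [size bs - k] entries leaves the first [k] steps. *)
Definition walk_of (bs : seq bool) (k : nat) : int := pos (drop (size bs - k) bs).

Definition nearest_neighbour (p : nat -> int) : Prop :=
  p 0%N = 0 /\ forall k, p k.+1 = p k + 1 \/ p k.+1 = p k - 1.

Lemma size_steps p n : size (steps p n) = n.
Proof. by elim: n => //= n ->. Qed.

Lemma walk_of_size bs : walk_of bs (size bs) = pos bs.
Proof. by rewrite /walk_of subnn drop0. Qed.

Lemma walk_of_cons b bs k : (k <= size bs)%N -> walk_of (b :: bs) k = walk_of bs k.
Proof. by move=> kn; rewrite /walk_of /= subSn. Qed.

Lemma walk_of0 bs : walk_of bs 0 = 0.
Proof. by rewrite /walk_of subn0 drop_size. Qed.

Lemma count_walk_of bs z :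
  count (fun j => walk_of bs j == z) (iota 0 (size bs).+1) = visits z bs.
Proof.
elim: bs => [|b bs IH]; first by rewrite /= addn0 -[walk_of _ _]/(pos [::]).
rewrite -[RHS]/((pos (b :: bs) == z) + visits z bs)%N -IH -walk_of_size.
rewrite -[in LHS]addn1 iotaD count_cat addnC; congr (_ + _)%N; first exact: addn0.
apply: eq_in_count => j; rewrite mem_iota add0n => /andP[_ hj].
by rewrite walk_of_cons.
Qed.

Lemma nvisits_eq s s' k : (forall j, (j <= k)%N -> s j = s' j) -> nvisits s k = nvisits s' k.
Proof.
move=> h; rewrite /nvisits; apply: eq_in_count => j.
by rewrite mem_iota add0n => /andP[_ hj]; rewrite !h.
Qed.

Lemma nearest_neighbour_pos p n : nearest_neighbour p -> p n = pos (steps p n).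
Proof.
move=> [p0 pS]; elim: n => [//|n IH] /=; rewrite -IH.
by case: eqP => // h; case: (pS n).
Qed.

Lemma nearest_neighbour_walk p n : nearest_neighbour p ->
  forall k, (k <= n)%N -> p k = walk_of (steps p n) k.
Proof.
move=> hp; elim: n => [|n IH] k; rewrite ?leqn0 => kn.
  by rewrite (eqP kn) walk_of0; case: hp.
case: (leqP k n) => kn'.
  by rewrite walk_of_cons ?size_steps// IH.
have -> : k = n.+1 by lia.
by rewrite -[X in walk_of _ X](size_steps p) walk_of_size -nearest_neighbour_pos.
Qed.

Section QuenchedLaw.
Variables (R : realType) (w : Env R) (Q : probability Path R).
Hypothesis w_range : forall (z : int) (i : nat), (0 < i)%N -> 2^-1 <= w z i <= 1.
Hypothesis lawQ : is_quenched_law w Q.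

Lemma prefix_prob_walk_of bs : prefix_prob w (walk_of bs) (size bs) = path_weight w bs.
Proof.
rewrite /prefix_prob walk_of0 eqxx; elim: bs => [|b bs IH]; first by rewrite big_ord0.
rewrite [size _]/= big_ord_recr /= mulrC; congr (_ * _); last first.
  rewrite -IH; apply: eq_bigr => k _; have kn := ltn_ord k.
  rewrite /step_prob !walk_of_cons//; try lia.
  rewrite (@nvisits_eq _ (walk_of bs))// => j jk.
  by rewrite walk_of_cons//; lia.
rewrite /step_prob -[(size bs).+1]/(size (b :: bs)) walk_of_size walk_of_cons//.
rewrite walk_of_size (@nvisits_eq _ (walk_of bs)); last first.
  by move=> j jk; rewrite walk_of_cons.
rewrite /nvisits walk_of_size count_walk_of -/(jump_prob w bs) /=.
case: b; first by rewrite eqxx.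
by rewrite (_ : (_ == pos bs + 1) = false) ?eqxx//; apply/eqP; lia.
Qed.

Lemma measurable_at n (z : int) : measurable [set p : Path | p n = z].
Proof. by apply: sub_sigma_algebra; exists n, z. Qed.

Lemma measurable_int_bigcup (F : int -> set Path) :
  (forall z, measurable (F z)) -> measurable (\bigcup_z F z).
Proof. by move=> h; apply: countable_bigcupT_measurable. Qed.

Lemma measurable_right_step n : measurable [set p : Path | p n.+1 = p n + 1].
Proof.
have -> : [set p : Path | p n.+1 = p n + 1] =
    \bigcup_z ([set p : Path | p n = z] `&` [set p : Path | p n.+1 = z + 1]).
  apply/seteqP; split=> p /=; first by move=> h; exists (p n).
  by move=> [z _ [<-]].
by apply: measurable_int_bigcup => z; apply: measurableI; exact: measurable_at.
Qed.

Lemma measurable_steps_eq bs : measurable [set p : Path | steps p (size bs) = bs].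
Proof.
elim: bs => [|b bs IH].
  by rewrite (_ : mkset _ = setT)//; apply/seteqP.
have -> : [set p : Path | steps p (size (b :: bs)) = b :: bs] =
    [set p : Path | (p (size bs).+1 == p (size bs) + 1) = b] `&`
    [set p : Path | steps p (size bs) = bs].
  by apply/seteqP; split=> p /=; [move=> [-> ->]|move=> [-> ->]].
apply: measurableI => //; have h := measurable_right_step (size bs).
case: b; first by rewrite (_ : mkset _ = [set p : Path | p (size bs).+1 = p (size bs) + 1])//;
  apply/seteqP; split=> p /= /eqP.
rewrite (_ : mkset _ = ~` [set p : Path | p (size bs).+1 = p (size bs) + 1]).
  exact: measurableC.
by apply/seteqP; split=> p /=; [move=> /eqP|move=> /eqP/negbTE].
Qed.

Lemma bigsetU_steps (F : pred (seq bool)) n :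
  [set p : Path | F (steps p n)] =
  \big[setU/set0]_(bs <- all_steps n | F bs) [set p : Path | steps p n = bs].
Proof.
rewrite -bigcup_seq_cond; apply/seteqP; split=> p /=.
  move=> Fp; exists (steps p n) => //=; rewrite Fp andbT.
  by rewrite -[X in all_steps X](size_steps p) mem_all_steps.
by move=> [bs /= /andP[_ Fbs] ->].
Qed.

Lemma measurable_steps (F : pred (seq bool)) n : measurable [set p : Path | F (steps p n)].
Proof.
rewrite bigsetU_steps big_seq_cond; apply: bigsetU_measurable => bs /andP[hbs _].
by rewrite -(size_all_steps hbs); exact: measurable_steps_eq.
Qed.

(** An exceptional path starts away from 0 or makes a forbidden step after a finite prefix; each
    such continuation is null, and there are countably many prefixes. *)
Lemma negligible_not_nearest_neighbour : Q.-negligible [set p : Path | ~ nearest_neighbour p].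
Proof.
pose bad (n : nat) (h : seq int) := 
  [set p : Path | (forall k, (k <= n.+1)%N -> p k = nth 0 h k) /\
     ~ (p n.+1 = p n + 1 \/ p n.+1 = p n - 1)].
have bad0 n h : Q.-negligible (bad n h).
  have [hb|hb] := pselect (nth 0 h n.+1 = nth 0 h n + 1 \/ nth 0 h n.+1 = nth 0 h n - 1).
    apply: negligibleS (@negligible_set0 _ _ _ _) => p [/= hp []].
    by rewrite !hp.
  exists [set p : Path | forall k, (k <= n.+1)%N -> p k = nth 0 h k]; split.
  - rewrite (_ : mkset _ = \bigcap_(k in `I_n.+2) [set p : Path | p k = nth 0 h k]).
      by apply: bigcap_measurable => [|k _]; [exists 0%N|exact: measurable_at].
    by apply/seteqP; split=> p /=.
  - rewrite lawQ /prefix_prob; case: ifP => // _; rewrite big_ord_recr /=.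
    rewrite /step_prob; case: eqP => [?|_]; first by case: hb; left.
    by case: eqP => [?|_]; [case: hb; right|rewrite mulr0].
  - by move=> p [].
have start0 : Q.-negligible [set p : Path | p 0%N <> 0].
  suff h0 : Q (~` [set p : Path | p 0%N = 0]) = 0%E.
    by exists (~` [set p : Path | p 0%N = 0]); split=> //; exact: measurableC (measurable_at 0 0).
  rewrite probability_setC; last exact: measurable_at.
  have := lawQ 0 (fun=> 0); rewrite /prefix_prob eqxx big_ord0.
  rewrite (_ : mkset _ = [set p : Path | p 0%N = 0]); first by move=> ->; rewrite subee.
  apply/seteqP; split=> p /=; first exact.
  by move=> p0 k; rewrite leqn0 => /eqP ->.
(* Pairs of a time and a list of integers are countable; [unpickle] enumerates them. *)
pose F i := if unpickle i is Some nh then bad nh.1 nh.2 else set0 : set Path.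
apply: negligibleS (negligibleU start0 (@negligible_bigcup _ _ _ _ F _)); last first.
  by move=> i; rewrite /F; case: unpickle => [[n h]|]; [exact: bad0|exact: negligible_set0].
move=> p /= hp; have [p0|p0] := pselect (p 0%N = 0); last by left.
right; apply: contrapT => hF; apply: hp; split=> // n; apply: contrapT => hn; apply: hF.
exists (pickle (n, [seq p k | k <- iota 0 n.+2])) => //.
rewrite /F pickleK /bad /=; split=> // k hk.
suff <- : nth 0 [seq p k | k <- iota 0 n.+2] k = p k by [].
by rewrite (nth_map 0%N) ?size_iota ?nth_iota.
Qed.

(** On nearest-neighbour paths the steps determine the positions, so the event lies in a cylinder up
    to a null set. *)
Lemma steps_measure_le bs : (Q [set p : Path | steps p (size bs) = bs] <= (path_weight w bs)%:E)%E.
Proof.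
have [N [mN N0 hN]] := negligible_not_nearest_neighbour.
pose A := [set p : Path | forall k, (k <= size bs)%N -> p k = walk_of bs k].
have mA : measurable A.
  rewrite (_ : A = \bigcap_(k in `I_(size bs).+1) [set p : Path | p k = walk_of bs k]).
    by apply: bigcap_measurable => [|k _]; [exists 0%N|exact: measurable_at].
  by apply/seteqP; split=> p /=.
rewrite -prefix_prob_walk_of -lawQ -/A -[leRHS]adde0 -N0.
apply: le_trans (measureU2 _ mA mN).
apply: le_measure; rewrite ?inE; [exact: measurable_steps_eq|exact: measurableU|].
move=> p /= hp; have [hnn|hnn] := pselect (nearest_neighbour p); last by right; exact: hN.
by left=> k hk; rewrite (nearest_neighbour_walk hnn hk) hp.
Qed.

Lemma steps_event_le (F : pred (seq bool)) n :
  (Q [set p : Path | F (steps p n)] <=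
    (\sum_(bs <- all_steps n | F bs) path_weight w bs)%:E)%E.
Proof.
rewrite bigsetU_steps -sumEFin.
have H : forall s, {subset s <= all_steps n} ->
  measurable (\big[setU/set0]_(bs <- s | F bs) [set p : Path | steps p n = bs]) /\
  (Q (\big[setU/set0]_(bs <- s | F bs) [set p : Path | steps p n = bs])
    <= \sum_(bs <- s | F bs) (path_weight w bs)%:E)%E.
  elim=> [|bs s IH] hs; first by rewrite !big_nil measure0.
  have [ms hle] := IH (fun x hx => hs x (mem_behead (hx : x \in behead (bs :: s)))).
  rewrite !big_cons; case: ifP => // _.
  have hbs := size_all_steps (hs bs (mem_head _ _)).
  have mbs : measurable [set p : Path | steps p n = bs].
    by rewrite -hbs; exact: measurable_steps_eq.
  split; first exact: measurableU.
  apply: le_trans (measureU2 _ mbs ms) _; apply: leeD => //.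
  by rewrite -hbs; exact: steps_measure_le.
by case: (H (all_steps n)).
Qed.

(** Borel-Cantelli: the geometric tails from [azuma_tail] are summable. *)
Lemma azuma_ae (Y : seq bool -> R) (C : R) : 1 <= C ->
  (forall b bs, `|Y (b :: bs) - Y bs| <= C) ->
  (forall bs, Y bs <= jump_prob w bs * Y (true :: bs) + (1 - jump_prob w bs) * Y (false :: bs)) ->
  forall d : R, 0 < d <= 1 ->
  {ae Q, forall p : Path, exists N, forall n, (N <= n)%N -> - d * n%:R < Y (steps p n)}.
Proof.
move=> C1 hY1 hY2 d hd.
have [r [A [/andP[r0 r1] A0 hA]]] := azuma_tail w_range C1 hY1 hY2 hd.
pose F n := [set p : Path | Y (steps p n) <= - d * n%:R].
have mF n : measurable (F n) := measurable_steps (fun bs => Y bs <= - d * n%:R) n.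
have : Q (lim_sup_set F) = 0.
  apply: lim_sup_set_cvg0 => //.
  apply: (@le_lt_trans _ _ (A / (1 - r))%:E); last exact: ltry.
  apply: lime_le; first exact: is_cvg_nneseries.
  apply: nearW => n.
  apply: (@le_trans _ _ (\sum_(0 <= k < n) (A * r ^+ k)%:E)%E).
    apply: lee_sum => k _; apply: (le_trans (steps_event_le (fun bs => Y bs <= - d * k%:R) k)).
    by rewrite lee_fin hA.
  rewrite sumEFin lee_fin big_mkord -mulr_sumr ler_wpM2l//.
  rewrite -[leRHS]mul1r ler_pdivlMr ?subr_gt0// mulrC.
  have := subrX1 r n; have : 0 <= r ^+ n by rewrite exprn_ge0.
  by move: (\sum_(_ < _) _) (r ^+ n) => s x; nra.
have mlim : measurable (lim_sup_set F).
  apply: bigcap_measurable => [|k _]; first by exists 0%N.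
  apply: bigcup_measurable => j _; exact: mF.
move=> /(negligibleP Q mlim); apply: negligibleS => p /= hp k _.
apply: contrapT => hk; apply: hp; exists k => n kn; rewrite ltNge; apply/negP => hn.
by apply: hk; exists n.
Qed.

End QuenchedLaw.

(** * Quenched speed *)

(** Otherwise the partial harmonic sums would be bounded and nondecreasing, hence convergent. *)
Lemma gain_unbounded (R : realType) (A : R) : exists2 L, (1 < L)%N & A <= gain R L.
Proof.
apply: contrapT => hA; apply: (@dvg_harmonic R).
apply: nondecreasing_is_cvgn.
  by apply: nondecreasing_series => n _ _; exact: harmonic_ge0.
exists `|A| => _ [n _ <-]; rewrite leNgt; apply/negP => hn; apply: hA.
(* With [L = n + 2] the harmonic tail from 1 contains the first [n] terms of the series. *)
exists n.+2 => //; rewrite gainE//; apply: le_trans (ler_norm A) _.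
apply: (le_trans (ltW hn)).
have : series harmonic n <= harmonic_tail R n.+2 1.
  rewrite /harmonic_tail /series /= -{1}(add0n 1%N) big_addn subn1 /=.
  rewrite [leRHS]big_nat_recr//=.
  have -> : \sum_(0 <= i < n) (i + 1)%:R^-1 = \sum_(0 <= i < n) i.+1%:R^-1 :> R.
    by apply: eq_bigr => i _; rewrite addn1.
  by rewrite lerDl invr_ge0.
have := harmonic_tail_ge0 R n.+2 1; move: (harmonic_tail _ _ _) (series _ _) => x y; lra.
Qed.

(** This form yields measurability and reduces the limit to countably many almost sure bounds. *)
Lemma speed_zeroE (R : realType) : @speed_zero R =
  \bigcap_k \bigcup_N \bigcap_(n in [set n | (N <= n)%N])
    [set p : Path | `|(p n)%:~R / n%:R| <= k.+1%:R^-1 :> R].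
Proof.
apply/seteqP; split=> p /=.
  move=> /cvgrPdist_le h k _.
  have [N _ hN] := h k.+1%:R^-1 ltac:(by rewrite invr_gt0).
  by exists N => // n /= Nn; have := hN n Nn; rewrite /= sub0r normrN.
move=> h; apply/cvgrPdist_le => e e0.
have [k hk] : exists k : nat, k.+1%:R^-1 <= e.
  exists (Num.truncn e^-1); rewrite invf_ple ?posrE//.
  by apply/ltW/truncnS_gt.
have [N _ hN] := h k I; exists N => // n /= Nn; rewrite sub0r normrN.
exact: le_trans (hN n Nn) hk.
Qed.

Lemma measurable_speed_zero (R : realType) : measurable (@speed_zero R).
Proof.
rewrite speed_zeroE; apply: bigcap_measurable => [|k _]; first by exists 0%N.
apply: bigcup_measurable => N _; apply: bigcap_measurable => [|n _]; first by exists N => /=.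
have -> : [set p : Path | `|(p n)%:~R / n%:R| <= k.+1%:R^-1 :> R] =
   \bigcup_z (if `|z%:~R / n%:R| <= k.+1%:R^-1 :> R then [set p : Path | p n = z] else set0).
  apply/seteqP; split=> p /=; first by move=> h; exists (p n) => //; rewrite h.
  by move=> [z _]; case: ifP => // h /= ->.
apply: measurable_int_bigcup => z; case: ifP => _; [exact: measurable_at|exact: measurable0].
Qed.

Section QuenchedSpeed.
Variables (R : realType) (w : Env R) (Q : probability Path R) (eta c C0 : R).
Hypothesis w_range : forall (z : int) (i : nat), (0 < i)%N -> 2^-1 <= w z i <= 1.
Hypothesis w_cookies : forall (x i : nat), (2 < i)%N -> w x%:Z i = 2^-1.
Hypothesis lawQ : is_quenched_law w Q.
Hypothesis eta_range : 0 < eta <= 1.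
Hypothesis c_gt0 : 0 < c.
Hypothesis soft_pairs_linear : forall n : nat,
  c * n%:R - C0 <= (\sum_(x < n) soft_pair w eta x)%:R.

Let filter_ae : Filter (nbhs (almost_everywhere Q)) := ae_filter_ringOfSetsType Q.

Lemma quenched_lower_bound (d : R) : 0 < d <= 1 ->
  {ae Q, forall p : Path, exists N, forall n, (N <= n)%N -> - d * n%:R <= (p n)%:~R}.
Proof.
move=> hd.
have incr b bs : `|(pos (b :: bs))%:~R - (pos bs)%:~R| <= 1 :> R.
  by rewrite -intrB; case: b => /=; rewrite addrAC subrr add0r ?intrN ?normrN normr1.
have drift bs : (pos bs)%:~R <= jump_prob w bs * (pos (true :: bs))%:~R
    + (1 - jump_prob w bs) * (pos (false :: bs))%:~R :> R.
  have /andP[p1 p2] := jump_prob_range w_range bs.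
  by rewrite /= intrD intrB; lra.
have := azuma_ae w_range lawQ (lexx 1) incr drift hd.
have : {ae Q, forall p : Path, nearest_neighbour p} := negligible_not_nearest_neighbour lawQ.
apply: (@filterS2 _ _ filter_ae) => p hp [N hN]; exists N => n Nn; rewrite (nearest_neighbour_pos _ hp).
exact/ltW/hN.
Qed.

(** Requiring [L <= M] discards at most [L] pairs. *)
Lemma late_pairs_ge L M : c * M%:R - C0 - L%:R <= (late_pairs w L eta M)%:R.
Proof.
rewrite lerBlDr; apply: le_trans (soft_pairs_linear M) _.
rewrite -natrD ler_nat /late_pairs; elim: M => [|M IH]; first by rewrite !big_ord0.
rewrite !big_ord_recr /= [late_pair _ _ _ _]/late_pair /=.
case: (leqP L M.+1) => /= LM; first by rewrite addnAC leq_add2r.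
rewrite addn0.
apply: (@leq_trans M.+1); last by rewrite (leq_trans (ltnW LM))// leq_addl.
rewrite -[leqRHS]addn1 leq_add ?leq_b1//.
by apply: (@leq_trans (\sum_(i < M) 1)); [apply: leq_sum => i _; exact: leq_b1|rewrite sum1_card card_ord].
Qed.

Lemma quenched_upper_bound (d : R) : 0 < d <= 1 ->
  {ae Q, forall p : Path, exists N, forall n, (N <= n)%N -> (p n)%:~R <= d * n%:R}.
Proof.
move=> /andP[d0 d1]; have /andP[e0 e1] := eta_range.
(* This [L] makes [eta^2 * gain * c * d >= 4]. Elapsed time, Azuma's error at rate 1 and the
   constants absorbed by [K] contribute at most [n] each, hence less than [4 n] in all. *)
have [L L1 hL] := gain_unbounded (4 / (eta ^+ 2 * c * d)).
have eta01 : 0 <= eta <= 1 by rewrite ltW.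
have B0 := excursion_bound_ge0 R L.
have C1 : 1 <= 1 + 3 * excursion_bound R L by lra.
have := azuma_ae w_range lawQ C1 (@time_potential_increment _ w _ _ L1 eta01)
  (time_potential_drift L1 w_range w_cookies eta01) (d := 1).
move=> /(_ ltac:(by rewrite ltr01 lexx)).
have : {ae Q, forall p : Path, nearest_neighbour p} := negligible_not_nearest_neighbour lawQ.
apply: (@filterS2 _ _ filter_ae) => p hp [N hN].
have [K hK] : exists K : nat,
    2 * excursion_bound R L + eta ^+ 2 * gain R L * (C0 + L%:R) <= K%:R.
  by exists (Num.truncn (2 * excursion_bound R L + eta ^+ 2 * gain R L * (C0 + L%:R))).+1;
    apply/ltW/truncnS_gt.
exists (maxn N K) => n; rewrite geq_max => /andP[Nn Kn].
rewrite (nearest_neighbour_pos _ hp).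
have := hN n Nn; rewrite /time_potential size_steps mulN1r.
have [ip iD _ _ _ _ _ _ _ _] := walk_state_inv (steps p n).
have hb := bonus_le w L1 eta01 iD; move: ip hb; move: (walk_state _) => s ip hb hY.
have hM : (pos (steps p n))%:~R <= (rmax s)%:R :> R.
  by rewrite ip intrB lerBlDr lerDl ler0n.
apply: (le_trans hM); have hN' := late_pairs_ge L (rmax s).
pose e := eta ^+ 2 * gain R L.
have e20 : 0 < eta ^+ 2 by rewrite exprn_gt0.
have g0 : 0 < gain R L by apply: lt_le_trans hL; rewrite divr_gt0// !mulr_gt0.
have ed : 4 <= e * c * d.
  have -> : e * c * d = gain R L * (eta ^+ 2 * c * d) by rewrite /e; ring.
  by rewrite -ler_pdivrMr ?mulr_gt0.
have e_gt0 : 0 < e by rewrite mulr_gt0.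
have h1 : e * (c * (rmax s)%:R - C0 - L%:R) <= e * (late_pairs w L eta (rmax s))%:R.
  by rewrite ler_pM2l.
have h2 : e * c * (rmax s)%:R <= 4 * n%:R.
  have : K%:R <= n%:R :> R by rewrite ler_nat.
  have : 0 <= n%:R :> R := ler0n _ _.
  by move: h1 hY hK hb; rewrite -/e mulr2n; move: (e) => x; lra.
have h3 : e * c * (rmax s)%:R <= e * c * (d * n%:R).
  apply: le_trans h2 _; rewrite mulrA ler_wpM2r ?ler0n//.
by move: h3; rewrite (ler_pM2l (mulr_gt0 e_gt0 c_gt0)).
Qed.

Lemma quenched_speed_zero : Q (@speed_zero R) = 1%E.
Proof.
have hk (k : nat) : {ae Q, forall p : Path, exists N, forall n, (N <= n)%N ->
    `|(p n)%:~R / n%:R| <= k.+1%:R^-1 :> R}.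
  have dk : 0 < (k.+1%:R^-1 : R) <= 1 by rewrite invr_gt0 ltr0n invf_le1 ?ltr0n// ler1n.
  move: (quenched_lower_bound dk) (quenched_upper_bound dk).
  apply: (@filterS2 _ _ filter_ae) => p [N1 h1] [N2 h2]; exists (maxn 1 (maxn N1 N2)) => n.
  rewrite !geq_max => /and3P[n0 n1 n2]; have := h1 n n1; have := h2 n n2.
  have n0' : 0 < n%:R :> R by rewrite ltr0n.
  by move=> a b; rewrite ler_norml ler_pdivrMr// ler_pdivlMr// a b.
have : {ae Q, forall p : Path, speed_zero R p}.
  have := ae_foralln hk; apply: filterS => p hp.
  rewrite speed_zeroE => k _; have [N hN] := hp k; by exists N.
move=> /(@measure_negligible _ _ _ _ _ (measurableC (@measurable_speed_zero R))).
move=> h; have <- : Q setT = 1%E := probability_setT Q.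
have mS := measurable_speed_zero R.
rewrite -(setvU (@speed_zero R)) measureU ?setICl//; last exact: measurableC.
by rewrite h add0e.
Qed.

End QuenchedSpeed.

(** * Linear growth of visit counts in ergodic systems *)

Section MaximalErgodic.
Context d (T : measurableType d) (R : realType) (P : probability T R).
Variables (theta : T -> T) (B : set T) (c : R).
Hypothesis mtheta : measurable_fun setT theta.
Hypothesis stationary : forall A, measurable A -> P A = P (theta @^-1` A).
Hypothesis mB : measurable B.
Hypothesis c_gt0 : 0 < c.

Definition visit_count (n : nat) (s : T) : R := \sum_(x < n) \1_B (iter x theta s).

(** The maximum over [n <= N] of [c n - visit_count n s], written recursively by splitting off the
    first term. *)
Fixpoint max_deficit (N : nat) (s : T) : R :=
  if N is N'.+1 then Num.max 0 (c - \1_B s + max_deficit N' (theta s)) else 0.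

Definition linear_visits : set T :=
  [set s | exists C : nat, forall n : nat, c * n%:R - C%:R <= visit_count n s].

Lemma visit_countS n s : visit_count n.+1 s = \1_B s + visit_count n (theta s).
Proof.
rewrite /visit_count big_ord_recl /=; congr (_ + _).
by apply: eq_bigr => i _; rewrite /= -iterS iterSr.
Qed.

Lemma max_deficit_ge0 N s : 0 <= max_deficit N s.
Proof. by case: N => //= N; rewrite le_max lexx. Qed.

Lemma max_deficit_le N s : max_deficit N s <= c *+ N.
Proof.
elim: N s => [//|N IH] s; rewrite [max_deficit _ _]/= ge_max; apply/andP; split.
  by rewrite mulrn_wge0// ltW.
by rewrite mulrS; apply: lerD => //; rewrite gerBl indicE ler0n.
Qed.

Lemma max_deficit_homo N s : max_deficit N s <= max_deficit N.+1 s.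
Proof.
elim: N s => [|N IH] s; first by rewrite max_deficit_ge0.
rewrite /= ge_max le_max lexx /= le_max; apply/orP; right.
by rewrite lerD2l; exact: IH.
Qed.

Lemma max_deficit_ge N n s : (n <= N)%N -> c * n%:R - visit_count n s <= max_deficit N s.
Proof.
elim: N n s => [|N IH] [|n] s // hn; rewrite ?mulr0 ?sub0r.
- by rewrite oppr_le0 /visit_count big_ord0.
- by rewrite /visit_count big_ord0 oppr0 max_deficit_ge0.
rewrite visit_countS /= le_max; apply/orP; right.
have := IH n (theta s) hn; rewrite -natr1.
move: (\1_B s) (visit_count _ _) (max_deficit _ _) => x y z; lra.
Qed.

Lemma measurable_max_deficit N : measurable_fun setT (max_deficit N).
Proof.
elim: N => [|N IH] /=; first exact: measurable_cst.
apply: measurable_maxr; first exact: measurable_cst.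
apply: measurable_funD; last exact: measurableT_comp.
by apply: measurable_funB; [exact: measurable_cst|exact: measurable_indic].
Qed.

Lemma measurable_iter n : measurable_fun setT (iter n theta).
Proof. by elim: n => [|n IH]; [exact: measurable_id|exact: measurableT_comp]. Qed.

Lemma measurable_visit_count n : measurable_fun setT (visit_count n).
Proof.
apply: measurable_sum => i; apply: measurableT_comp; last exact: measurable_iter.
exact: measurable_indic.
Qed.

Lemma measurable_linear_visits : measurable linear_visits.
Proof.
have -> : linear_visits = \bigcup_(C : nat) \bigcap_(n : nat)
    (visit_count n @^-1` `[c * n%:R - C%:R, +oo[).
  apply/seteqP; split=> s /=.
    by move=> [C hC]; exists C => // n _ /=; rewrite in_itv/= andbT.
  by move=> [C _ hC]; exists C => n; have := hC n I; rewrite /= in_itv/= andbT.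
apply: bigcup_measurable => C _; apply: bigcap_measurable => [|n _]; first by exists 0%N.
by rewrite -[X in measurable X]setTI; apply: measurable_visit_count.
Qed.

(** [ergodic_nonneg] asks for exact invariance, hence the free constant in [linear_visits]: the
    shift costs at most 1, which [C + 1] absorbs. *)
Lemma linear_visits_invariant : c <= 1 -> theta @^-1` linear_visits = linear_visits.
Proof.
move=> c1; apply/seteqP; split=> s /= [C hC]; exists C.+1 => n.
  case: n => [|n]; first by rewrite /visit_count big_ord0 mulr0 sub0r oppr_le0 ler0n.
  have := hC n; rewrite visit_countS -natr1 -[C.+1%:R]natr1.
  have : 0 <= \1_B s :> R by rewrite indicE ler0n.
  by move: (\1_B s) (visit_count _ _) => x y; lra.
have := hC n.+1; rewrite visit_countS -natr1 -[C.+1%:R]natr1.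
have : \1_B s <= 1 :> R by rewrite indicE lern1 leq_b1.
by have := c_gt0; move: (\1_B s) (visit_count _ _) => x y; lra.
Qed.

Let A N := [set s | 0 < max_deficit N s].

Let mA N : measurable (A N).
Proof.
have -> : A N = max_deficit N @^-1` `]0, +oo[.
  by apply/seteqP; split=> s; rewrite /A /= in_itv/= andbT.
by rewrite -[X in measurable X]setTI; apply: measurable_max_deficit.
Qed.

(* Garsia's argument: h = c - 1_B satisfies M_{N+1} = h + M_N o theta on {M_{N+1} > 0}. *)
Lemma maximal_ergodic N : (P (B `&` A N.+1) <= c%:E)%E.
Proof.
have mM k : measurable_fun setT (EFin \o max_deficit k).
  by apply/measurable_EFinP; exact: measurable_max_deficit.
have mMt k : measurable_fun setT (EFin \o (max_deficit k \o theta)).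
  by apply/measurable_EFinP; apply: measurableT_comp => //; exact: measurable_max_deficit.
have intc (r : R) : (\int[P]_s (cst r%:E s) = r%:E)%E.
  by rewrite integral_cst// -[RHS]mule1; congr (_ * _)%E; exact: probability_setT.
have M0 k s : (0 <= (max_deficit k s)%:E)%E by rewrite lee_fin max_deficit_ge0.
have inv : (\int[P]_s (max_deficit N.+1 (theta s))%:E = \int[P]_s (max_deficit N.+1 s)%:E)%E.
  have := @ge0_integral_pushforward _ _ _ _ R _ mtheta P setT _ measurableT (mM N.+1)
    (fun s _ => M0 _ s).
  rewrite preimage_setT => <-.
  by apply: eq_measure_integral => X mX _; exact/esym/stationary.
have fin : (\int[P]_s (max_deficit N.+1 s)%:E)%E \is a fin_num.
  rewrite ge0_fin_numE ?integral_ge0//.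
  apply: (@le_lt_trans _ _ (\int[P]_s (cst (c *+ N.+1)%:E s))%E).
    apply: ge0_le_integral => //; first exact: mM.
    by move=> s _; rewrite lee_fin max_deficit_le.
  by rewrite intc ltry.
have mBA : measurable (B `&` A N.+1) by exact: measurableI.
have mI : measurable_fun setT (EFin \o (\1_(B `&` A N.+1) : T -> R)).
  by apply/measurable_EFinP; exact: measurable_indic.
have mc : measurable_fun setT (cst c%:E : T -> \bar R) by exact: measurable_cst.
(* The integrands compare pointwise: on [A N.+1] by the recursion and monotonicity in [N], elsewhere
   because the left one is 0. By [inv] and [fin] the integrals of [max_deficit] then cancel. *)
have : (\int[P]_s ((max_deficit N.+1 s)%:E + (\1_(B `&` A N.+1) s)%:E)
    <= \int[P]_s (c%:E + (max_deficit N.+1 (theta s))%:E))%E.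
  apply: ge0_le_integral => //.
  - by move=> s _; rewrite adde_ge0// lee_fin indicE ler0n.
  - exact: (emeasurable_funD (mM _) mI).
  - exact: (emeasurable_funD mc (mMt N.+1)).
  move=> s _; rewrite -!EFinD lee_fin indicE in_setI.
  have h := max_deficit_homo N (theta s); have h' := max_deficit_ge0 N (theta s).
  have hc := ltW c_gt0.
  have [hs|hs] := pselect (A N.+1 s).
    rewrite (mem_set hs) andbT; move: hs; rewrite /A /= lt_max ltxx /= => hs.
    rewrite (max_idPr (ltW hs)) indicE.
    by rewrite addrAC subrK lerD2l.
  rewrite (memNset hs) andbF addr0; move/negP: hs; rewrite /A /= -leNgt => hs.
  by apply: (le_trans hs); rewrite addr_ge0// le_max lexx.
rewrite ge0_integralD//; last exact: (mM N.+1).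
rewrite ge0_integralD//; last 2 first.
- by move=> s _; rewrite lee_fin ltW.
- exact: (mMt N.+1).
rewrite inv integral_indic// setIT (intc c).
by rewrite addeC leeD2rE.
Qed.

(** A point of [B] outside every [A N.+1] has linear visits with constant 0, and the union of the
    sets in [maximal_ergodic] has probability at most [c < P B]. *)
Lemma visits_linear_positive : (c%:E < P B)%E -> P linear_visits != 0%E.
Proof.
move=> cB; apply/negP => /eqP E0.
have mBA N : measurable (B `&` A N.+1) by exact: measurableI.
have mU : measurable (\bigcup_N (B `&` A N.+1)) by exact: bigcup_measurable.
have hU : (P (\bigcup_N (B `&` A N.+1)) <= c%:E)%E.
  have homoA : {homo (fun N => B `&` A N.+1) : n m / (n <= m)%N >-> (n <= m)%O}.
    apply/nondecreasing_seqP => N; rewrite subsetEset; apply: setIS => s.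
    by rewrite /A /= => /lt_le_trans; apply; exact: (max_deficit_homo N.+1 s).
  have cv := nondecreasing_cvg_mu (mu := P) mBA mU homoA.
  rewrite -(cvg_lim _ cv)//; apply: lime_le; first exact: cvgP cv.
  by apply: nearW => N; exact: maximal_ergodic.
have : (P B <= P (\bigcup_N (B `&` A N.+1)) + P linear_visits)%E.
  apply: le_trans (measureU2 _ mU measurable_linear_visits).
  apply: le_measure; rewrite ?inE//.
    by apply: measurableU => //; exact: measurable_linear_visits.
  move=> s Bs; have [h|h] := pselect (linear_visits s); [by right|left].
  have [n hn] : exists n : nat, visit_count n s < c * n%:R.
    apply: contrapT => hn; apply: h; exists 0%N => n; rewrite subr0 leNgt.
    by apply/negP => h'; apply: hn; exists n.
  exists n => //; split=> //; rewrite /A /=.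
  apply: lt_le_trans (max_deficit_ge s (leqnSn n)) => //; by rewrite subr_gt0.
by rewrite E0 adde0 => /le_trans/(_ hU); rewrite leNgt cB.
Qed.

End MaximalErgodic.

(** * Random environments *)

Lemma ae_of_probability1 d (T : measurableType d) (R : realType) (P : probability T R)
  (A : set T) : measurable A -> P A = 1%E -> {ae P, forall x, A x}.
Proof.
move=> mA PA; exists (~` A); split=> //; first exact: measurableC.
by have := probability_setC P mA; rewrite PA subee.
Qed.

Lemma measurable_env_coordinate (R : realType) (z : int) (i : nat) (S : set R) :
  measurable S -> measurable [set w : Env R | S (w z i)].
Proof. by move=> mS; apply: sub_sigma_algebra; exists z, i, S. Qed.

Lemma measurable_seq_coordinate (R : realType) (x i : nat) (S : set R) :
  measurable S -> measurable [set s : EnvSeq R | S (s x i)].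
Proof. by move=> mS; apply: sub_sigma_algebra; exists x, i, S. Qed.

Lemma measurable_env_nonneg (R : realType) : measurable_fun setT (@env_nonneg R).
Proof.
refine (@measurability _ _ (Env R : measurableType _) (EnvSeq R : measurableType _)
  setT (@env_nonneg R) (@seq_gen R) erefl _) => _ [_ [x [i [S [mS ->]]]] <-].
by rewrite setTI; exact: (@measurable_env_coordinate R x i S mS).
Qed.

(** Lets [distribution P env_nonneg] denote the law of the half-line environment. *)
HB.instance Definition _ (R : realType) :=
  isMeasurableFun.Build _ _ _ _ (@env_nonneg R) (@measurable_env_nonneg R).

Lemma measurable_seq_shift (R : realType) : measurable_fun setT (@seq_shift R).
Proof.
refine (@measurability _ _ (EnvSeq R : measurableType _) (EnvSeq R : measurableType _)
  setT (@seq_shift R) (@seq_gen R) erefl _) => _ [_ [x [i [S [mS ->]]]] <-].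
by rewrite setTI; exact: (@measurable_seq_coordinate R x.+1 i S mS).
Qed.

Lemma iter_seq_shift (R : realType) (s : EnvSeq R) n x i :
  iter n (@seq_shift R) s x i = s (n + x)%N i.
Proof. by elim: n x => //= n IH x; rewrite /seq_shift IH addnS. Qed.

Lemma measurable_Omega_plus (R : realType) : measurable (@Omega_plus R).
Proof.
have -> : @Omega_plus R =
  ~` \bigcup_z \bigcup_(i in [set i | (1 <= i)%N]) ~` [set w : Env R | 2^-1 <= w z i <= 1].
  apply/seteqP; split=> w /=; first by move=> h [z _ [i i1]] /=; apply; exact: h.
  by move=> h z i i1; apply: contrapT => hn; apply: h; exists z => //; exists i.
apply: measurableC; apply: countable_bigcupT_measurable => // z.
apply: bigcup_measurable => i _; apply: measurableC.
have := @measurable_env_coordinate R z i `[2^-1, 1] (measurable_itv _).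
by under [X in measurable X -> _]eq_set do rewrite /= in_itv.
Qed.

Section Environment.
Variables (R : realType) (P : probability (Env R) R).
Hypothesis stationaryP : stationary_nonneg P.

(** Stationarity carries the statement from site 0 to every [x] by induction, and a countable
    intersection remains. *)
Lemma cookies_ae :
  (forall i : nat, (3 <= i)%N -> P [set w : Env R | w (0:int) i = 2^-1] = 1%E) ->
  {ae P, forall w : Env R, forall x i : nat, (2 < i)%N -> w x%:Z i = 2^-1}.
Proof.
move=> h0; apply: ae_foralln => x; apply: ae_foralln => i.
have [i2|i2] := leqP i 2; first by apply: aeW.
suff : P [set w : Env R | w x%:Z i = 2^-1] = 1%E.
  move=> hx; have mx := @measurable_env_coordinate R x i [set 2^-1] (measurable_set1 _).
  exact: (filterS _ (ae_of_probability1 mx hx)).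
elim: x => [|x <-]; first exact: h0.
have mx := @measurable_seq_coordinate R x i [set 2^-1] (measurable_set1 _).
exact/esym/(stationaryP mx).
Qed.

Definition soft_pair_set (eta : R) : set (EnvSeq R) :=
  [set s | s 0%N 1%N <= 1 - eta /\ s 1%N 1%N <= 1 - eta].

Lemma measurable_soft_pair_set eta : measurable (soft_pair_set eta).
Proof.
have h x := @measurable_seq_coordinate R x 1%N `]-oo, 1 - eta] (measurable_itv _).
rewrite (_ : soft_pair_set eta = [set s : EnvSeq R | `]-oo, 1 - eta]%classic (s 0%N 1%N)]
   `&` [set s : EnvSeq R | `]-oo, 1 - eta]%classic (s 1%N 1%N)]); first exact: measurableI.
by apply/seteqP; split=> s /=; rewrite !in_itv.
Qed.

(** Countable subadditivity: the event with both first cookies below 1 is covered by the soft pair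
    events for [eta = 1 / (k + 1)]. *)
Lemma soft_pair_set_positive :
  (0%E < P [set w : Env R | (w (0:int) 1%N < 1)%R /\ (w (1:int) 1%N < 1)%R])%E ->
  exists2 eta : R, 0 < eta <= 1 & (0 < distribution P (@env_nonneg R) (soft_pair_set eta))%E.
Proof.
move=> h0; apply: contrapT => hn.
have P0 (k : nat) : P ((@env_nonneg R) @^-1` soft_pair_set k.+1%:R^-1) = 0%E.
  apply/eqP; rewrite -measure_le0 leNgt; apply/negP => hk; apply: hn.
  exists k.+1%:R^-1 => //.
  by rewrite invr_gt0 ltr0n invf_le1 ?ltr0n// ler1n.
have m k : measurable ((@env_nonneg R) @^-1` soft_pair_set k.+1%:R^-1).
  rewrite -[X in measurable X]setTI; apply: measurable_env_nonneg => //.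
  exact: measurable_soft_pair_set.
have mA : measurable [set w : Env R | (w (0:int) 1%N < 1)%R /\ (w (1:int) 1%N < 1)%R].
  have h z := @measurable_env_coordinate R z 1%N `]-oo, 1[ (measurable_itv _).
  rewrite (_ : mkset _ = [set w : Env R | `]-oo, 1[%classic (w (0 : int) 1%N)]
     `&` [set w : Env R | `]-oo, 1[%classic (w (1 : int) 1%N)]); first exact: measurableI.
  by apply/seteqP; split=> s /=; rewrite !in_itv.
suff : P.-negligible [set w : Env R | (w (0:int) 1%N < 1)%R /\ (w (1:int) 1%N < 1)%R].
  by move=> /(measure_negligible mA) h; move: h0; rewrite h ltxx.
have : P.-negligible (\bigcup_k ((@env_nonneg R) @^-1` soft_pair_set k.+1%:R^-1)).
  by apply: negligible_bigcup => k; apply/(negligibleP P (m k))/P0.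
apply: negligibleS => w /= [w0 w1].
pose e := Num.min (1 - w (0 : int) 1%N) (1 - w (1 : int) 1%N).
have e0 : 0 < e by rewrite lt_min !subr_gt0 w0.
have hk : (Num.truncn e^-1).+1%:R^-1 <= e.
  by rewrite invf_ple ?posrE//; apply/ltW/truncnS_gt.
exists (Num.truncn e^-1) => //; move: hk; rewrite /e le_min => /andP[h1 h2].
by split; rewrite /env_nonneg; [move: h1|move: h2]; move: (_^-1) => x; lra.
Qed.

(** The maximal inequality gives linear growth with positive probability; ergodicity raises this to
    1. *)
Lemma soft_pairs_ae (eta : R) : ergodic_nonneg P ->
  (0 < distribution P (@env_nonneg R) (soft_pair_set eta))%E ->
  exists2 c : R, 0 < c & {ae P, forall w : Env R, exists C : nat, forall n : nat,
    c * n%:R - C%:R <= (\sum_(x < n) soft_pair w eta x)%:R :> R}.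
Proof.
move=> ergP pos0; pose mu : probability (EnvSeq R) R := distribution P (@env_nonneg R).
have muS A : measurable A -> mu A = mu (@seq_shift R @^-1` A) by exact: stationaryP.
have mB := measurable_soft_pair_set eta.
have mshift := @measurable_seq_shift R.
have fmu : mu (soft_pair_set eta) \is a fin_num by exact: fin_num_measure.
(* Half the probability, so that [c < mu B] strictly, as [visits_linear_positive] requires. *)
pose c := fine (mu (soft_pair_set eta)) / 2.
have pos1 : 0 < fine (mu (soft_pair_set eta)).
  by rewrite -lte_fin fineK.
have c0 : 0 < c by rewrite divr_gt0.
have le1 : fine (mu (soft_pair_set eta)) <= 1.
  by rewrite -lee_fin fineK// probability_le1.
have c1 : c <= 1 by rewrite /c; move: (fine _) le1 pos1 => x; lra.
exists c => //.
have mE := @measurable_linear_visits _ _ R (@seq_shift R) _ c mshift mB.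
have hE : P (@env_nonneg R @^-1` linear_visits (@seq_shift R) (soft_pair_set eta) c) = 1%E.
  have [h|//] := ergP _ mE (@linear_visits_invariant _ _ R _ _ _ c0 c1).
  have : (c%:E < mu (soft_pair_set eta))%E.
    by rewrite -[ltRHS]fineK// lte_fin /c; move: (fine _) pos1 => x; lra.
  move=> /(@visits_linear_positive _ _ R mu _ _ _ mshift muS mB c0).
  by rewrite -[X in X != _]/(P (_ @^-1` _)) h eqxx.
have mE' : measurable (@env_nonneg R @^-1` linear_visits (@seq_shift R) (soft_pair_set eta) c).
  by rewrite -[X in measurable X]setTI; exact: measurable_env_nonneg.
apply: filterS (ae_of_probability1 mE' hE) => w [C hC]; exists C => n.
rewrite (le_trans (hC n))// /visit_count natr_sum; apply: ler_sum => x _.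
rewrite indicE ler_nat; case: (boolP (_ \in _)) => // /set_mem [].
by rewrite !iter_seq_shift addn0 addn1 /env_nonneg /soft_pair /soft => -> ->.
Qed.

End Environment.

Theorem mainTheorem19 (R : realType) (P : probability (Env R) R)
  (K : Env R -> probability Path R) :
  P (@Omega_plus R) = 1%E ->
  stationary_nonneg P ->
  ergodic_nonneg P ->
  (forall i : nat, (3 <= i)%N -> P [set w : Env R | w (0:int) i = 2^-1] = 1%E) ->
  (0%E < P [set w : Env R | (w (0:int) 1%N < 1)%R /\ (w (1:int) 1%N < 1)%R])%E ->
  (forall w, @Omega_plus R w -> is_quenched_law w (K w)) ->
  (forall A : set Path, measurable A -> measurable_fun setT (fun w : Env R => K w A)) ->
  (\int[P]_w K w (@speed_zero R) = 1)%E.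
Proof.
move=> hO hs he hc hp hK mK.
have [eta eta01 eta_pos] := soft_pair_set_positive hp.
have [c c0 hsoft] := soft_pairs_ae hs he eta_pos.
(* For almost every environment the quenched result applies, so the annealed integrand is 1. *)
have speed1 : {ae P, forall w : Env R, K w (@speed_zero R) = 1%E}.
  have FP : Filter (nbhs (almost_everywhere P)) := ae_filter_ringOfSetsType P.
  move: (ae_of_probability1 (@measurable_Omega_plus R) hO) (cookies_ae hs hc) hsoft.
  apply: filterS3 => w hw hcw [C hC].
  exact: (quenched_speed_zero hw hcw (hK w hw) eta01 c0 hC).
transitivity (\int[P]_w cst 1%E w)%E.
  apply: ae_eq_integral => //; first by apply: mK; exact: measurable_speed_zero.
  by apply: filterS speed1.
rewrite integral_cst// mul1e; exact: probability_setT.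
Qed.
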